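(* Let $\phi$ be a sufficiently smooth function on an open set $D\subset\mathbb{R}^2$, let $\kappa=\kappa(x)$ be a function of the independent variable alone, and consider the first-order ODE $u'(x)=\phi(x,u)$ with associated curvature $\mathcal{K}(x,u)=-(\phi_{xu}+\phi_u^2+\phi\,\phi_{uu})(x,u)$. Then $\mathcal{K}(x,u)=\kappa(x)$ on $D$ if and only if, for every solution $f$ of $u'=\phi(x,u)$, the function $$p_f(x):=\phi_u(x,f(x))$$ satisfies the Riccati equation $$p'(x)+p(x)^2+\kappa(x)=0$$ on its interval of definition.
   Context: The vector field of the ODE is $A=\partial_x+\phi\,\partial_u$. On $D$ one takes the Riemannian metric $g=(1+\phi^2)\,dx\otimes dx-\phi\,dx\otimes du-\phi\,du\otimes dx+du\otimes du$, with volume form $dx\wedge du$. Its Gauss curvature is $\mathcal{K}(x,u)=-\partial_u(A(\phi))=-(\phi_{xu}+\phi_u^2+\phi\,\phi_{uu})$, and the divergence of $A$ is $\phi_u$. Subscripts denote partial derivatives. Standing assumptions: $\phi$ is sufficiently smooth on the open set $D$; for every $x\in\mathbb{R}$ the fiber $D_x=\{u\in\mathbb{R}:(x,u)\in D\}$ is connected (possibly empty or unbounded). Assertions are local: $D$ and the intervals of definition of solutions may be shrunk so that all quantities are defined and sufficiently smooth. A solution is a function $f$ on an open interval with graph in $D$ and $f'(x)=\phi(x,f(x))$. *)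

(* Defs.v *)
From Stdlib Require Import Reals.
From Coquelicot Require Import Coquelicot.

Open Scope R_scope.

(* Real-analysis functions are total: phi : R -> R -> R is only meaningful on
   the open set D, and all statements below only involve its germs at points
   of D. *)

(* Subscript notation: [d_x phi] is phi_x and [d_u (d_x phi)] is phi_{xu}. *)
Definition d_x (phi : R -> R -> R) : R -> R -> R :=
  fun x u => Derive (fun y => phi y u) x.

Definition d_u (phi : R -> R -> R) : R -> R -> R :=
  fun x u => Derive (fun v => phi x v) u.

(* Coquelicot's [ex_diff_n phi n x u] says that the iterated partial
   derivatives of phi up to order n exist at (x, u) and are continuous there;
   asking for it at every point of an open set D means phi is C^n on D. *)
Definition smooth_on (n : nat) (D : R * R -> Prop) (phi : R -> R -> R) : Prop :=
  forall x u : R, D (x, u) -> ex_diff_n phi n x u.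

Definition connected_fibers (D : R * R -> Prop) : Prop :=
  forall x : R, is_connected (fun u => D (x, u)).

(* Gauss curvature of the metric
     (1 + phi^2) dx^2 - 2 phi dx du + du^2,
   i.e. - d_u (A phi) for the vector field A = d_x + phi d_u of the ODE. *)
Definition curvature (phi : R -> R -> R) (x u : R) : R :=
  - (d_u (d_x phi) x u + (d_u phi x u) ^ 2 + phi x u * d_u (d_u phi) x u).

(* The open interval ]a, b[ may be unbounded: a and b are extended reals. *)
Definition in_interval (a b : Rbar) (x : R) : Prop :=
  Rbar_lt a x /\ Rbar_lt x b.

Definition is_solution (D : R * R -> Prop) (phi : R -> R -> R)
    (a b : Rbar) (f : R -> R) : Prop :=
  Rbar_lt a b /\
  forall x : R, in_interval a b x ->
    D (x, f x) /\ is_derive f x (phi x (f x)).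

Definition divergence_along (phi : R -> R -> R) (f : R -> R) : R -> R :=
  fun x => d_u phi x (f x).

Definition satisfies_riccati (kappa : R -> R) (a b : Rbar) (p : R -> R) : Prop :=
  forall x : R, in_interval a b x ->
    ex_derive p x /\ Derive p x + (p x) ^ 2 + kappa x = 0.

(* Main.v *)
Require Import Defs.
From Stdlib Require Import Reals Lra Lia.
From Coquelicot Require Import Coquelicot.
Open Scope R_scope.

(** The chain rule and Schwarz's theorem give, along a solution [f],
      [p_f' + p_f^2 = (phi_xu + phi phi_uu + phi_u^2)(x, f x) = - K(x, f x)],
    so the Riccati equation for [p_f] says exactly that [K = kappa] on the graph
    of [f].  The converse needs the graphs of solutions to cover [D]: this is
    the Picard-Lindeloef theorem, applied to [phi] precomposed with the
    retraction of the plane onto a small rectangle, which makes it globally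
    bounded and Lipschitz. *)

(** * Retraction of the line onto a closed interval, and Lipschitz functions *)

Definition clamp (c r x : R) : R := Rmax (c - r) (Rmin (c + r) x).

Lemma clamp_near (c r x : R) : 0 <= r -> Rabs (clamp c r x - c) <= r.
Proof.
  intros Hr; apply Rabs_le.
  unfold clamp, Rmax, Rmin; repeat destruct Rle_dec; lra.
Qed.

Lemma clamp_id (c r x : R) : Rabs (x - c) <= r -> clamp c r x = x.
Proof.
  intros H; apply Rabs_le_between in H.
  unfold clamp, Rmax, Rmin; repeat destruct Rle_dec; lra.
Qed.

Lemma clamp_1_lipschitz (c r x y : R) :
  0 <= r -> Rabs (clamp c r x - clamp c r y) <= Rabs (x - y).
Proof.
  intros Hr; unfold clamp, Rmax, Rmin, Rabs.
  repeat destruct Rle_dec; repeat destruct Rcase_abs; lra.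
Qed.

Lemma lipschitz_continuous (M : R) (f : R -> R) :
  (forall x y, Rabs (f x - f y) <= M * Rabs (x - y)) ->
  forall x, continuous f x.
Proof.
  intros Hf x.
  assert (HM : 0 <= M).
  { specialize (Hf 1 0). pose proof (Rabs_pos (f 1 - f 0)).
    rewrite Rminus_0_r, Rabs_R1 in Hf. lra. }
  apply filterlim_locally; intros eps.
  (* Dividing by [M + 1] instead of [M] covers the case [M = 0]. *)
  assert (Hd : 0 < eps / (M + 1)) by (apply Rdiv_lt_0_compat; [apply cond_pos | lra]).
  exists (mkposreal _ Hd); intros y Hy.
  change (Rabs (y - x) < eps / (M + 1)) in Hy.
  change (Rabs (f y - f x) < eps).
  apply Rle_lt_trans with ((M + 1) * Rabs (y - x)).
  - pose proof (Rabs_pos (y - x)). specialize (Hf y x). lra.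
  - apply Rlt_le_trans with ((M + 1) * (eps / (M + 1))).
    + apply Rmult_lt_compat_l; lra.
    + right; field; lra.
Qed.

Lemma clamp_continuous (c r x : R) : 0 <= r -> continuous (clamp c r) x.
Proof.
  intros Hr; apply (lipschitz_continuous 1).
  intros y z; rewrite Rmult_1_l; now apply clamp_1_lipschitz.
Qed.

(** * Sequences with geometrically decreasing steps *)

Lemma half_pow_lim (C : R) : is_lim_seq (fun n => C * (1 / 2) ^ n) 0.
Proof.
  replace (Finite 0) with (Rbar_mult C 0) by (simpl; f_equal; ring).
  apply is_lim_seq_scal_l, is_lim_seq_geom.
  rewrite Rabs_pos_eq; lra.
Qed.

Lemma half_pow_bound_eq_0 (d C : R) :
  (forall n : nat, Rabs d <= C * (1 / 2) ^ n) -> d = 0.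
Proof.
  intros H.
  assert (Hle : Rbar_le (Rabs d) 0).
  { apply (is_lim_seq_le _ _ _ _ H); [apply is_lim_seq_const | apply half_pow_lim]. }
  simpl in Hle; pose proof (Rabs_pos d).
  destruct (Req_dec d 0) as [|Hd]; auto.
  apply Rabs_pos_lt in Hd; lra.
Qed.

Lemma is_lim_seq_Rabs_sub_le (u : nat -> R) (l a C : R) :
  is_lim_seq u l -> eventually (fun n => Rabs (u n - a) <= C) -> Rabs (l - a) <= C.
Proof.
  intros Hu HC.
  assert (H : is_lim_seq (fun n => Rabs (u n - a)) (Rabs (l - a))).
  { apply (is_lim_seq_abs _ (l - a)), is_lim_seq_minus'; auto using is_lim_seq_const. }
  exact (is_lim_seq_le_loc _ _ _ _ HC H (is_lim_seq_const C)).
Qed.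

(** The steps telescope, and the geometric tail from index [n] sums to twice its first term; hence
    the Cauchy property, and the factor 2 in the error bound. *)
Lemma geometric_steps_lim (u : nat -> R) (C : R) :
  (forall n, Rabs (u (S n) - u n) <= C * (1 / 2) ^ n) ->
  is_lim_seq u (real (Lim_seq u)) /\
  forall n, Rabs (Lim_seq u - u n) <= 2 * C * (1 / 2) ^ n.
Proof.
  intros Hu.
  assert (HC : 0 <= C).
  { specialize (Hu 0%nat); simpl in Hu. pose proof (Rabs_pos (u 1%nat - u 0%nat)). lra. }
  (* The factor [1 - (1 / 2) ^ m] is the exact finite geometric sum. It lets the induction on [m]
     close, which the plain bound [2 * C * (1 / 2) ^ n] would not. *)
  assert (Hm : forall n m, Rabs (u (n + m)%nat - u n)
                           <= 2 * C * (1 / 2) ^ n * (1 - (1 / 2) ^ m)).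
  { intros n m; induction m as [|m IH].
    - rewrite Nat.add_0_r, Rminus_diag, Rabs_R0; simpl; lra.
    - rewrite Nat.add_succ_r.
      replace (u (S (n + m)) - u n)
        with ((u (S (n + m)) - u (n + m)%nat) + (u (n + m)%nat - u n)) by ring.
      eapply Rle_trans; [apply Rabs_triang|].
      eapply Rle_trans; [apply Rplus_le_compat; [apply Hu | apply IH]|].
      rewrite pow_add; simpl; lra. }
  assert (Hnm : forall n m, (n <= m)%nat -> Rabs (u m - u n) <= 2 * C * (1 / 2) ^ n).
  { intros n m H. replace m with (n + (m - n))%nat by lia.
    eapply Rle_trans; [apply Hm|].
    assert (0 <= 2 * C * (1 / 2) ^ n) by (apply Rmult_le_pos; [lra | apply pow_le; lra]).
    assert (0 <= (1 / 2) ^ (m - n)) by (apply pow_le; lra).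
    rewrite <- (Rmult_1_r (2 * C * (1 / 2) ^ n)) at 2.
    apply Rmult_le_compat_l; lra. }
  assert (Hlim : is_lim_seq u (real (Lim_seq u))).
  { apply Lim_seq_correct', ex_lim_seq_cauchy_corr; intros eps.
    assert (He : 0 < eps / 2) by (pose proof (cond_pos eps); lra).
    pose proof (half_pow_lim (2 * C)) as H0.
    apply is_lim_seq_spec in H0.
    destruct (H0 (mkposreal _ He)) as [N HN]; simpl in HN.
    specialize (HN N (Nat.le_refl N)); rewrite Rminus_0_r in HN.
    apply Rabs_lt_between in HN.
    exists N; intros n m Hn Hm'.
    replace (u n - u m) with ((u n - u N) - (u m - u N)) by ring.
    eapply Rle_lt_trans; [apply Rabs_triang|]; rewrite Rabs_Ropp.
    pose proof (Hnm N n Hn); pose proof (Hnm N m Hm'); lra. }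
  split; [exact Hlim|]; intros n.
  apply (is_lim_seq_Rabs_sub_le u); [exact Hlim|].
  exists n; intros m; apply Hnm.
Qed.

(** * Picard iteration for a globally bounded and Lipschitz right-hand side *)

Definition picard_op (psi : R -> R -> R) (x0 u0 : R) (g : R -> R) : R -> R :=
  fun x => u0 + RInt (fun t => psi t (g t)) x0 x.

Fixpoint picard_iter (psi : R -> R -> R) (x0 u0 : R) (n : nat) : R -> R :=
  match n with
  | O => fun _ => u0
  | S n => picard_op psi x0 u0 (picard_iter psi x0 u0 n)
  end.

Lemma continuous_2d_comp (psi : R -> R -> R) (f g : R -> R) (x : R) :
  continuity_2d_pt psi (f x) (g x) -> continuous f x -> continuous g x ->
  continuous (fun t => psi (f t) (g t)) x.
Proof.
  intros Hpsi Hf Hg.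
  apply (continuous_comp_2 f g psi); auto.
  now apply continuity_2d_pt_filterlim.
Qed.

Lemma picard_op_init (psi : R -> R -> R) (x0 u0 : R) (g : R -> R) :
  picard_op psi x0 u0 g x0 = u0.
Proof. unfold picard_op; rewrite RInt_point; apply Rplus_0_r. Qed.

(** This is the fundamental theorem of calculus. With [psi] and [g] continuous everywhere, the
    integrand is integrable on every segment and the formula holds at every [x]. *)
Lemma picard_op_derive (psi : R -> R -> R) (x0 u0 : R) (g : R -> R) (x : R) :
  (forall x u, continuity_2d_pt psi x u) -> (forall t, continuous g t) ->
  is_derive (picard_op psi x0 u0 g) x (psi x (g x)).
Proof.
  intros Hpsi Hg; unfold picard_op.
  assert (Hc : forall t, continuous (fun t => psi t (g t)) t).
  { intros t; apply (continuous_2d_comp psi (fun t => t) g); auto using continuous_id. }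
  rewrite <- (Rplus_0_l (psi x (g x))).
  apply @is_derive_plus; [apply @is_derive_const|].
  apply (is_derive_RInt (fun t => psi t (g t)) _ x0); [|apply Hc].
  apply filter_forall; intros y; apply @RInt_correct, @ex_RInt_continuous; auto.
Qed.

Section Picard.

Variables (psi : R -> R -> R) (x0 u0 M L h : R).
Hypothesis psi_cont : forall x u, continuity_2d_pt psi x u.
Hypothesis psi_bound : forall x u, Rabs (psi x u) <= M.
Hypothesis psi_lipschitz :
  forall x u v, Rabs (psi x u - psi x v) <= L * Rabs (u - v).
Hypothesis L_ge0 : 0 <= L.
Hypothesis h_ge0 : 0 <= h.
Hypothesis Lh_le : L * h <= 1 / 2.

(** The derivative [psi t (g t)] is bounded by [M] whatever the continuous function [g], so the
    constant is uniform over all iterates. *)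
Lemma picard_op_lipschitz (g : R -> R) (x y : R) :
  (forall t, continuous g t) ->
  Rabs (picard_op psi x0 u0 g x - picard_op psi x0 u0 g y) <= M * Rabs (x - y).
Proof.
  intros Hg; apply bounded_variation with (fun t => psi t (g t)).
  intros t _; split; [now apply picard_op_derive | apply psi_bound].
Qed.

(** The difference of the two images vanishes at [x0] and its derivative is at most [L * C] within
    distance [h] of [x0]. The mean value inequality gives [L * C * h], and [L * h <= 1 / 2] turns
    this into a contraction of ratio one half. *)
Lemma picard_op_contract (g1 g2 : R -> R) (C : R) :
  (forall t, continuous g1 t) -> (forall t, continuous g2 t) ->
  (forall t, Rabs (t - x0) <= h -> Rabs (g1 t - g2 t) <= C) ->
  forall x, Rabs (x - x0) <= h ->
  Rabs (picard_op psi x0 u0 g1 x - picard_op psi x0 u0 g2 x) <= C / 2.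
Proof.
  intros H1 H2 HC x Hx.
  assert (HC0 : 0 <= C).
  { eapply Rle_trans; [apply Rabs_pos | apply (HC x Hx)]. }
  apply Rle_trans with (L * C * Rabs (x - x0)).
  - rewrite <- (Rminus_0_r (picard_op _ _ _ g1 x - _)).
    replace 0 with (picard_op psi x0 u0 g1 x0 - picard_op psi x0 u0 g2 x0)
      by (rewrite !picard_op_init; ring).
    apply (bounded_variation
             (fun t => picard_op psi x0 u0 g1 t - picard_op psi x0 u0 g2 t)
             (fun t => psi t (g1 t) - psi t (g2 t))).
    intros t Ht; split.
    + apply @is_derive_minus; now apply picard_op_derive.
    + eapply Rle_trans; [apply psi_lipschitz|].
      apply Rmult_le_compat_l; auto; apply HC; lra.
  - apply Rle_trans with (L * C * h).
    + apply Rmult_le_compat_l; auto; now apply Rmult_le_pos.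
    + replace (L * C * h) with (C * (L * h)) by ring.
      replace (C / 2) with (C * (1 / 2)) by field.
      now apply Rmult_le_compat_l.
Qed.

Lemma picard_iter_continuous (n : nat) (x : R) :
  continuous (picard_iter psi x0 u0 n) x.
Proof.
  revert x; induction n as [|n IH]; intros x; simpl.
  - apply continuous_const.
  - apply @ex_derive_continuous; eexists; now apply picard_op_derive.
Qed.

(** The first step moves the constant [u0] by at most [M * h]; each later step is halved by the
    contraction. *)
Lemma picard_iter_step (n : nat) (x : R) :
  Rabs (x - x0) <= h ->
  Rabs (picard_iter psi x0 u0 (S n) x - picard_iter psi x0 u0 n x)
  <= M * h * (1 / 2) ^ n.
Proof.
  revert x; induction n as [|n IH]; intros x Hx.
  - simpl.
    rewrite <- (picard_op_init psi x0 u0 (fun _ => u0)) at 2.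
    rewrite Rmult_1_r.
    eapply Rle_trans;
      [apply picard_op_lipschitz; intros; apply continuous_const|].
    apply Rmult_le_compat_l; auto.
    eapply Rle_trans; [apply Rabs_pos | apply (psi_bound 0 0)].
  - change (picard_iter psi x0 u0 (S (S n)))
      with (picard_op psi x0 u0 (picard_iter psi x0 u0 (S n))).
    change (picard_iter psi x0 u0 (S n))
      with (picard_op psi x0 u0 (picard_iter psi x0 u0 n)) at 2.
    replace (M * h * (1 / 2) ^ S n) with (M * h * (1 / 2) ^ n / 2)
      by (simpl; field).
    apply picard_op_contract; auto using picard_iter_continuous.
Qed.

(* The limit is taken at the clamped abscissa so that it is continuous on the
   whole line, as [picard_op_derive] requires. *)
Definition picard_lim (x : R) : R :=
  Lim_seq (fun n => picard_iter psi x0 u0 n (clamp x0 h x)).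

Lemma picard_lim_spec (x : R) :
  is_lim_seq (fun n => picard_iter psi x0 u0 n (clamp x0 h x)) (picard_lim x) /\
  forall n, Rabs (picard_lim x - picard_iter psi x0 u0 n (clamp x0 h x))
            <= 2 * (M * h) * (1 / 2) ^ n.
Proof.
  apply geometric_steps_lim; intros n.
  now apply picard_iter_step, clamp_near.
Qed.

Lemma picard_lim_continuous (x : R) : continuous picard_lim x.
Proof.
  apply (lipschitz_continuous M); clear x; intros x y.
  rewrite <- (Rminus_0_r (picard_lim x - picard_lim y)).
  apply (is_lim_seq_Rabs_sub_le
           (fun n => picard_iter psi x0 u0 n (clamp x0 h x)
                     - picard_iter psi x0 u0 n (clamp x0 h y))).
  - apply is_lim_seq_minus'; apply picard_lim_spec.
  (* From index 1 on, every iterate is an image of [picard_op], hence [M]-Lipschitz; this bound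
     passes to the limit. *)
  - exists 1%nat; intros [|n] Hn; [lia|].
    rewrite Rminus_0_r.
    eapply Rle_trans; [apply picard_op_lipschitz, picard_iter_continuous|].
    apply Rmult_le_compat_l; [|now apply clamp_1_lipschitz].
    eapply Rle_trans; [apply Rabs_pos | apply (psi_bound 0 0)].
Qed.

(** Both sides are close to the iterate of index [n + 1]: the left one by contraction of the error
    at index [n], the right one by the error bound itself. Each distance is at most
    [M * h * (1 / 2) ^ n]. *)
Lemma picard_lim_fixed (x : R) :
  Rabs (x - x0) <= h -> picard_op psi x0 u0 picard_lim x = picard_lim x.
Proof.
  intros Hx; apply Rminus_diag_uniq.
  apply half_pow_bound_eq_0 with (2 * (M * h)); intros n.
  assert (Hn : forall m t, Rabs (t - x0) <= h ->
    Rabs (picard_lim t - picard_iter psi x0 u0 m t) <= 2 * (M * h) * (1 / 2) ^ m).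
  { intros m t Ht; rewrite <- (clamp_id x0 h t Ht) at 2; apply picard_lim_spec. }
  replace (picard_op psi x0 u0 picard_lim x - picard_lim x)
    with ((picard_op psi x0 u0 picard_lim x - picard_iter psi x0 u0 (S n) x)
          - (picard_lim x - picard_iter psi x0 u0 (S n) x)) by ring.
  eapply Rle_trans; [apply Rabs_triang|]; rewrite Rabs_Ropp.
  assert (H1 := picard_op_contract _ _ _ picard_lim_continuous
                  (picard_iter_continuous n) (Hn n) x Hx).
  assert (H2 := Hn (S n) x Hx); simpl in H2 |- *; lra.
Qed.

Lemma picard_lindelof_global :
  exists f : R -> R,
    (forall x, Rabs (x - x0) <= h -> Rabs (f x - u0) <= M * Rabs (x - x0)) /\
    (forall x, Rabs (x - x0) <= h -> is_derive f x (psi x (f x))).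
Proof.
  (* The image of the limit is chosen rather than the limit: they agree when [Rabs (x - x0) <= h],
     but [picard_lim] is constant beyond the endpoints, whereas its image has a two-sided derivative
     there too. *)
  exists (picard_op psi x0 u0 picard_lim); split; intros x Hx.
  - rewrite <- (picard_op_init psi x0 u0 picard_lim) at 2.
    apply picard_op_lipschitz, picard_lim_continuous.
  - rewrite (picard_lim_fixed x Hx).
    apply picard_op_derive; [exact psi_cont | exact picard_lim_continuous].
Qed.

End Picard.

(** * Local existence of solutions through a given point *)

Lemma continuity_2d_pt_locally_bounded (g : R -> R -> R) (x u : R) :
  continuity_2d_pt g x u ->
  locally_2d (fun y v => Rabs (g y v) <= Rabs (g x u) + 1) x u.
Proof.
  intros Hg; destruct (Hg (mkposreal 1 Rlt_0_1)) as [d Hd].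
  exists d; intros y v Hy Hv; specialize (Hd y v Hy Hv); simpl in Hd.
  replace (g y v) with ((g y v - g x u) + g x u) by ring.
  eapply Rle_trans; [apply Rabs_triang | lra].
Qed.

(** The predicate [P] serves to keep the graph of the solution inside a prescribed neighbourhood,
    such as an open domain. *)
Lemma picard_lindelof_local (phi : R -> R -> R) (P : R -> R -> Prop) (x0 u0 : R) :
  locally_2d (fun x u => continuity_2d_pt phi x u /\
                         ex_derive (fun v => phi x v) u) x0 u0 ->
  continuity_2d_pt (d_u phi) x0 u0 ->
  locally_2d P x0 u0 ->
  exists (h : posreal) (f : R -> R), f x0 = u0 /\
    forall x, Rabs (x - x0) < h -> P x (f x) /\ is_derive f x (phi x (f x)).
Proof.
  intros Hphi Hdu HP.
  set (M := Rabs (phi x0 u0) + 1); set (L := Rabs (d_u phi x0 u0) + 1).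
  assert (HM : 0 < M) by (pose proof (Rabs_pos (phi x0 u0)); unfold M; lra).
  assert (HL : 0 < L) by (pose proof (Rabs_pos (d_u phi x0 u0)); unfold L; lra).
  assert (Hall : locally_2d (fun x u =>
     (continuity_2d_pt phi x u /\ ex_derive (fun v => phi x v) u) /\
     Rabs (phi x u) <= M /\ Rabs (d_u phi x u) <= L /\ P x u) x0 u0).
  { apply locally_2d_and; [exact Hphi|].
    apply locally_2d_and; [|apply locally_2d_and; [|exact HP]].
    - apply continuity_2d_pt_locally_bounded.
      apply locally_2d_singleton in Hphi; apply Hphi.
    - now apply continuity_2d_pt_locally_bounded. }
  destruct Hall as [d Hd].
  (* Halving [d] puts the closed square of radius [r] inside the open one where all the bounds
     hold. *)
  set (r := d / 2).
  assert (Hr : 0 < r) by (pose proof (cond_pos d); unfold r; lra).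
  assert (Hrd : forall t, Rabs t <= r -> Rabs t < d)
    by (pose proof (cond_pos d); unfold r; intros; lra).
  set (psi := fun x u => phi (clamp x0 r x) (clamp u0 r u)).
  assert (Hcl : forall c x, Rabs (clamp c r x - c) < d)
    by (intros; apply Hrd, clamp_near; lra).
  (* The three terms keep the abscissa in the square, make the Picard operator a contraction, and
     keep the graph from leaving the square vertically. *)
  set (h := Rmin r (Rmin (/ (2 * L)) (r / M))).
  assert (Hh : 0 < h).
  { repeat apply Rmin_pos; auto.
    - apply Rinv_0_lt_compat; lra.
    - now apply Rdiv_lt_0_compat. }
  assert (Hhr : h <= r) by apply Rmin_l.
  assert (HLh : L * h <= 1 / 2).
  { apply Rle_trans with (L * / (2 * L)).
    - apply Rmult_le_compat_l; [lra|].
      eapply Rle_trans; [apply Rmin_r | apply Rmin_l].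
    - right; field; lra. }
  assert (HMh : M * h <= r).
  { apply Rle_trans with (M * (r / M)).
    - apply Rmult_le_compat_l; [lra|].
      eapply Rle_trans; [apply Rmin_r | apply Rmin_r].
    - right; field; lra. }
  destruct (picard_lindelof_global psi x0 u0 M L h) as [f [Hf Hf']]; try lra.
  - intros x u; apply continuity_2d_pt_filterlim.
    apply (continuous_comp_2 (fun z : R * R => clamp x0 r (fst z))
             (fun z : R * R => clamp u0 r (snd z)) phi).
    + apply continuous_comp; [apply continuous_fst | apply clamp_continuous; lra].
    + apply continuous_comp; [apply continuous_snd | apply clamp_continuous; lra].
    + apply continuity_2d_pt_filterlim, Hd; apply Hcl.
  - intros x u; apply Hd; apply Hcl.
  - intros x u v.
    assert (Hin : forall t, Rmin (clamp u0 r v) (clamp u0 r u) <= t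
                            <= Rmax (clamp u0 r v) (clamp u0 r u) -> Rabs (t - u0) < d).
    { intros t Ht; apply Hrd, Rabs_le.
      pose proof (clamp_near u0 r u (Rlt_le _ _ Hr)) as Hu.
      pose proof (clamp_near u0 r v (Rlt_le _ _ Hr)) as Hv.
      apply Rabs_le_between in Hu, Hv; revert Ht.
      unfold Rmin, Rmax; destruct Rle_dec; lra. }
    (* The mean value theorem in [u] turns the bound [L] on [d_u phi] into a Lipschitz constant; the
       segment between two clamped values stays in the square. *)
    destruct (MVT_gen (fun w => phi (clamp x0 r x) w) (clamp u0 r v) (clamp u0 r u)
                (d_u phi (clamp x0 r x))) as (c & Hc & Heq).
    + intros t Ht; apply Derive_correct, Hd; [apply Hcl | apply Hin; lra].
    + intros t Ht; apply continuity_pt_filterlim, @ex_derive_continuous, Hd;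
        [apply Hcl | apply Hin; lra].
    + unfold psi; rewrite Heq, Rabs_mult.
      apply Rmult_le_compat; try apply Rabs_pos.
      * apply Hd; auto.
      * apply clamp_1_lipschitz; lra.
  - exists (mkposreal h Hh), f; split.
    (* The initial condition is the estimate [Hf] at [x0], whose right-hand side is 0. *)
    + apply Rminus_diag_uniq.
      assert (Hx0 : Rabs (x0 - x0) = 0) by (rewrite Rminus_diag; apply Rabs_R0).
      specialize (Hf x0); rewrite Hx0, Rmult_0_r in Hf.
      specialize (Hf (Rlt_le _ _ Hh)).
      pose proof (Rabs_pos (f x0 - u0)).
      destruct (Req_dec (f x0 - u0) 0) as [|Hne]; auto.
      apply Rabs_pos_lt in Hne; lra.
    + simpl; intros x Hx.
      assert (Hfx : Rabs (f x - u0) <= r).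
      { eapply Rle_trans; [apply Hf; lra|].
        apply Rle_trans with (M * h); auto.
        apply Rmult_le_compat_l; lra. }
      split; [apply Hd; apply Hrd; lra|].
      (* The graph lies in the square, where both clamps are the identity. *)
      replace (phi x (f x)) with (psi x (f x)); [apply Hf'; lra|].
      unfold psi; rewrite !clamp_id; auto; lra.
Qed.

(** * Differentiating the divergence along a solution *)

(** The increment splits into a horizontal part, controlled by the continuity of [d_x g], and a
    vertical part, controlled by the derivative in [u] at the point. It is meant for [g = d_u phi],
    as the chain rule requires. *)
Lemma differentiable_pt_lim_C1 (g : R -> R -> R) (x u : R) :
  locally_2d (fun y v => ex_derive (fun z => g z v) y) x u ->
  ex_derive (fun v => g x v) u ->
  continuity_2d_pt (d_x g) x u ->
  differentiable_pt_lim g x u (d_x g x u) (d_u g x u).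
Proof.
  intros Hx Hu Hc; apply filterdiff_differentiable_pt_lim.
  apply (is_derive_filterdiff g x u (d_x g)).
  - apply locally_2d_locally in Hx; revert Hx; apply filter_imp.
    intros z Hz; now apply Derive_correct.
  - now apply Derive_correct.
  - now apply continuity_2d_pt_filterlim.
Qed.

Lemma locally_2d_open (D : R * R -> Prop) (x u : R) :
  open D -> D (x, u) -> locally_2d (fun y v => D (y, v)) x u.
Proof.
  intros HD Hxu; apply locally_2d_locally.
  generalize (HD _ Hxu); apply filter_imp; now intros [y v].
Qed.

Lemma divergence_along_derive (D : R * R -> Prop) (phi : R -> R -> R)
    (f : R -> R) (x : R) :
  open D -> smooth_on 2 D phi -> D (x, f x) -> is_derive f x (phi x (f x)) ->
  is_derive (divergence_along phi f) x
    (- curvature phi x (f x) - (divergence_along phi f x) ^ 2).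
Proof.
  intros HD Hphi Hx Hf.
  assert (Hloc := locally_2d_open D x (f x) HD Hx).
  (* The chain rule produces the derivative in [x] of [d_u phi], while [curvature] contains the
     mixed derivative in the other order. *)
  assert (Hschwarz : d_x (d_u phi) x (f x) = d_u (d_x phi) x (f x)).
  { apply Schwarz.
    - revert Hloc; apply locally_2d_impl, locally_2d_forall.
      intros y v Hyv; destruct (Hphi y v Hyv) as (_ & ? & ? & Hdx & Hdu).
      destruct Hdx as (_ & _ & ? & _); destruct Hdu as (_ & ? & _); auto.
    - destruct (Hphi _ _ Hx) as (_ & _ & _ & _ & _ & _ & _ & H & _); apply H.
    - destruct (Hphi _ _ Hx) as (_ & _ & _ & (_ & _ & _ & _ & H) & _); apply H. }
  assert (Hdiff : differentiable_pt_lim (d_u phi) x (f x)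
            (d_x (d_u phi) x (f x)) (d_u (d_u phi) x (f x))).
  { apply differentiable_pt_lim_C1.
    - revert Hloc; apply locally_2d_impl, locally_2d_forall.
      intros y v Hyv; apply (Hphi y v Hyv).
    - apply (Hphi _ _ Hx).
    - destruct (Hphi _ _ Hx) as (_ & _ & _ & _ & _ & _ & _ & H & _); apply H. }
  replace (- curvature phi x (f x) - (divergence_along phi f x) ^ 2)
    (* Chain rule along the curve [t] to [(t, f t)]: its velocity has components 1 and
       [phi x (f x)]. *)
    with (d_x (d_u phi) x (f x) * 1 + d_u (d_u phi) x (f x) * phi x (f x))
    by (rewrite Hschwarz; unfold curvature, divergence_along; ring).
  apply is_derive_Reals.
  apply (derivable_pt_lim_comp_2d (d_u phi) (fun t => t) f); auto.
  - apply derivable_pt_lim_id.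
  - now apply is_derive_Reals.
Qed.

Theorem theorem3p1 (D : R * R -> Prop) (phi : R -> R -> R) (kappa : R -> R)
    (D_open : open D)
    (D_fibers : connected_fibers D)
    (phi_smooth : smooth_on 2 D phi) :
  (forall x u : R, D (x, u) -> curvature phi x u = kappa x) <->
  (forall (a b : Rbar) (f : R -> R), is_solution D phi a b f ->
     satisfies_riccati kappa a b (divergence_along phi f)).
Proof.
  split.
  - intros HK a b f [_ Hf] x Hx; destruct (Hf x Hx) as [HD Hd].
    assert (Hp := divergence_along_derive D phi f x D_open phi_smooth HD Hd).
    split; [eexists; exact Hp|].
    rewrite (is_derive_unique _ _ _ Hp), (HK _ _ HD); ring.
  - intros HR x u HD.
    (* An arbitrary point of [D] is placed on the graph of a solution, at the centre of its
       interval. *)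
    destruct (picard_lindelof_local phi (fun y v => D (y, v)) x u)
      as (h & f & Hfx & Hf).
    + generalize (locally_2d_open D x u D_open HD).
      apply locally_2d_impl, locally_2d_forall.
      intros y v Hyv; destruct (phi_smooth y v Hyv) as (? & _ & ? & _); auto.
    + destruct (phi_smooth x u HD) as (_ & _ & _ & _ & H & _); exact H.
    + now apply locally_2d_open.
    + pose proof (cond_pos h) as Hh.
      assert (Hsol : is_solution D phi (x - h) (x + h) f).
      { split; [simpl; lra|].
        intros y [H1 H2]; simpl in H1, H2; apply Hf, Rabs_def1; lra. }
      destruct (HR _ _ _ Hsol x) as [_ Hric]; [split; simpl; lra|].
      assert (Hx0 : Rabs (x - x) < h) by (rewrite Rminus_diag, Rabs_R0; lra).
      assert (Hp := divergence_along_derive D phi f x D_open phi_smooth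
                      (proj1 (Hf x Hx0)) (proj2 (Hf x Hx0))).
      (* The squares of the divergence cancel, leaving [- curvature phi x u + kappa x = 0]. *)
      rewrite (is_derive_unique _ _ _ Hp), Hfx in Hric; lra.
Qed.
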